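(* Let $1\le P\le n$, let $\boldsymbol{a}^{(1)},\dots,\boldsymbol{a}^{(P)}\in\mathbb{R}^n$ be linearly independent, let $T^{\mathbb{P}}=\sum_{k=1}^P \boldsymbol{a}^{(k)}\otimes\boldsymbol{a}^{(k)}\otimes\boldsymbol{a}^{(k)}$, and let $$m_3^{\mathbb{P}}(s) = f_0 + g^Ts + \frac12 H[s]^2 + \frac16 T^{\mathbb{P}}[s]^3 + \frac{\sigma}{4}\|s\|_W^4,\qquad s\in\mathbb{R}^n .$$ Let $C\in\mathbb{R}^{n\times n}$ be the matrix whose first $P$ rows are $(\boldsymbol{a}^{(1)})^T,\dots,(\boldsymbol{a}^{(P)})^T$ and whose last $n-P$ rows are $(\boldsymbol{a}_\perp^{(P+1)})^T,\dots,(\boldsymbol{a}_\perp^{(n)})^T$, where $\boldsymbol{a}_\perp^{(P+1)},\dots,\boldsymbol{a}_\perp^{(n)}\in\mathbb{R}^n$ are linearly independent vectors with $(\boldsymbol{a}^{(i)})^T\boldsymbol{a}_\perp^{(j)}=0$ for all $i=1,\dots,P$ and $j=P+1,\dots,n$. Define $$\tilde s = Cs,\quad \tilde g = C^{-T}g,\quad \tilde H = C^{-T}HC^{-1},\quad \tilde W = C^{-T}WC^{-1},\quad \mathcal{T}=\operatorname{diag}\{t_j\}_{1\le j\le n},$$ where $t_1=\dots=t_P=1$ and $t_{P+1}=\dots=t_n=0$. Then, for every $s\in\mathbb{R}^n$, $$\tilde m(\tilde s) := f_0 + \tilde g^T\tilde s + \frac12\tilde s^T\tilde H\tilde s + \frac16\mathcal{T}[\tilde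 s]^3 + \frac{\sigma}{4}\|\tilde s\|_{\tilde W}^4 = m_3^{\mathbb{P}}(s).$$
   Context: Here $f_0\in\mathbb{R}$, $g\in\mathbb{R}^n$, $H\in\mathbb{R}^{n\times n}$ is symmetric, $\sigma>0$, and $W\in\mathbb{R}^{n\times n}$ is symmetric positive definite; for a symmetric positive definite matrix $V$, $\|v\|_V=\sqrt{v^TVv}$. $H[s]^2=s^THs$; for a third-order tensor $T$, $T[s]^3=\sum_{i,j,k}T_{ijk}s_is_js_k$, so that $T^{\mathbb{P}}[s]^3=\sum_{k=1}^P\big((\boldsymbol{a}^{(k)})^Ts\big)^3$. $\operatorname{diag}\{t_j\}$ denotes the $n\times n\times n$ diagonal tensor with $(j,j,j)$ entries $t_j$ and all other entries zero, so $\mathcal{T}[s]^3=\sum_j t_js_j^3$. $C^{-T}$ denotes $(C^{-1})^T$. *)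

(* Defs.v *)
From HB Require Import structures.
From mathcomp Require Import all_boot all_order all_algebra.
From mathcomp Require Import reals.

Set Implicit Arguments.
Unset Strict Implicit.
Unset Printing Implicit Defensive.

Import Order.TTheory GRing.Theory Num.Theory.
Local Open Scope ring_scope.

Definition dotv (R : realType) (n : nat) (u v : 'cV[R]_n) : R :=
  (u^T *m v) 0 0.

Definition quad (R : realType) (n : nat) (A : 'M[R]_n) (s : 'cV[R]_n) : R :=
  (s^T *m A *m s) 0 0.

Definition sym_posdef (R : realType) (n : nat) (V : 'M[R]_n) : Prop :=
  V \is symmetricmx /\ forall v : 'cV[R]_n, v != 0 -> 0 < quad V v.

(* The norm ||v||_V; it is a norm when [sym_posdef V]. *)
Definition normv (R : realType) (n : nat) (V : 'M[R]_n) (v : 'cV[R]_n) : R :=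
  Num.sqrt (quad V v).

Definition tensor3 (R : realType) (n : nat) : Type :=
  'I_n -> 'I_n -> 'I_n -> R.

Definition tensor_app (R : realType) (n : nat) (T : tensor3 R n)
    (s : 'cV[R]_n) : R :=
  \sum_(i < n) \sum_(j < n) \sum_(k < n) T i j k * s i 0 * s j 0 * s k 0.

Definition outer3 (R : realType) (n : nat) (a b c : 'cV[R]_n) : tensor3 R n :=
  fun i j k => a i 0 * b j 0 * c k 0.

Definition sum_cubes_tensor (R : realType) (n P : nat)
    (a : 'I_P -> 'cV[R]_n) : tensor3 R n :=
  fun i j k => \sum_(l < P) outer3 (a l) (a l) (a l) i j k.

Definition diag_tensor (R : realType) (n : nat) (t : 'I_n -> R) : tensor3 R n :=
  fun i j k => if (i == j) && (j == k) then t j else 0.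

Definition model (R : realType) (n : nat) (f0 : R) (g : 'cV[R]_n)
    (H : 'M[R]_n) (T : tensor3 R n) (sigma : R) (W : 'M[R]_n)
    (s : 'cV[R]_n) : R :=
  f0 + dotv g s + 1 / 2 * quad H s + 1 / 6 * tensor_app T s
  + sigma / 4 * normv W s ^+ 4.

(* The n x n matrix with rows (a 0)^T, ..., (a P-1)^T, then (b 0)^T, ...,
   (b (n-P-1))^T; the cast identifies P + (n - P) with n. *)
Definition stack_rows (R : realType) (n P : nat) (hPn : (P <= n)%N)
    (a : 'I_P -> 'cV[R]_n) (b : 'I_(n - P) -> 'cV[R]_n) : 'M[R]_n :=
  castmx (subnKC hPn, erefl n)
    (col_mx (\matrix_(k < P) (a k)^T) (\matrix_(k < n - P) (b k)^T)).

(* Main.v *)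
(* Substituting s' = C s cancels C against its inverse in the linear, quadratic
   and norm terms, and the first P coordinates of C s are the numbers
   (a k)^T s, whose cubes sum to the tensor term. The matrix C is invertible
   because a vector common to the row spaces of its two blocks is orthogonal to
   itself, hence zero. *)
Require Import Defs.
From HB Require Import structures.
From mathcomp Require Import all_boot all_order all_algebra.
From mathcomp Require Import reals ring.

Set Implicit Arguments.
Unset Strict Implicit.
Unset Printing Implicit Defensive.

Import Order.TTheory GRing.Theory Num.Theory.
Local Open Scope ring_scope.

Lemma dotvE (R : realType) (n : nat) (u v : 'cV[R]_n) :
  dotv u v = \sum_k u k 0 * v k 0.
Proof. by rewrite /dotv mxE; apply: eq_bigr => k _; rewrite mxE. Qed.

Lemma row_free_rows (R : realType) (m n : nat) (a : 'I_m -> 'cV[R]_n) :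
  free (codom a) -> row_free (\matrix_k (a k)^T).
Proof.
move=> fa; apply: inj_row_free => v v0.
(* [codom a] is convertible to the tuple of the [a i], which is the form in which [freeP] speaks of
   vanishing linear combinations. *)
have /freeP fa' : free [tuple a i | i < m] by [].
apply/rowP => i; rewrite mxE; apply: fa'.
transitivity ((v *m \matrix_k (a k)^T)^T); last by rewrite v0 trmx0.
rewrite mulmx_sum_row linear_sum; apply: eq_bigr => k _.
by rewrite -tnth_nth tnth_mktuple linearZ /= rowK trmxK.
Qed.

Lemma row_free_col_mx_orth (R : realFieldType) (m p n : nat)
    (A : 'M[R]_(m, n)) (B : 'M[R]_(p, n)) :
  row_free A -> row_free B -> A *m B^T = 0 -> row_free (col_mx A B).
Proof.
move=> fA fB AB0; apply: inj_row_free => v.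
rewrite -[v]hsubmxK mul_row_col; move: (lsubmx v) (rsubmx v) => x y xy0.
have yBE : y *m B = - (x *m A) by apply/eqP; rewrite -addr_eq0 addrC xy0.
have norm0 : (x *m A) *m (x *m A)^T = 0.
  (* Only the second factor becomes [- (y *m B)], so that the product [A *m B^T] appears and
     vanishes. *)
  rewrite -[x *m A in X in _ *m X]opprK -yBE linearN /= mulmxN.
  by rewrite trmx_mul -mulmxA [A *m _]mulmxA AB0 mul0mx mulmx0 oppr0.
have xA0 : x *m A = 0.
  (* The single entry of [norm0] is a sum of squares over an ordered field, so every coordinate is
     zero. *)
  apply/rowP => k; move/matrixP/(_ 0 0): norm0; rewrite mxE [RHS]mxE => /eqP.
  rewrite psumr_eq0 => [/allP /(_ k)|j _]; last by rewrite [_^T _ _]mxE -expr2 sqr_ge0.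
  rewrite mem_index_enum [_^T _ _]mxE -expr2 sqrf_eq0 => /(_ isT) /eqP ->.
  by rewrite mxE.
have yB0 : y *m B = 0 by rewrite yBE xA0 oppr0.
have -> : x = 0 by apply: (row_free_inj fA); rewrite /= xA0 mul0mx.
have -> : y = 0 by apply: (row_free_inj fB); rewrite /= yB0 mul0mx.
exact: row_mx0.
Qed.

Lemma stack_rows_unit (R : realType) (n P : nat) (hPn : (P <= n)%N)
    (a : 'I_P -> 'cV[R]_n) (b : 'I_(n - P) -> 'cV[R]_n) :
  free (codom a) -> free (codom b) ->
  (forall i j, dotv (a i) (b j) = 0) -> stack_rows hPn a b \in unitmx.
Proof.
move=> fa fb ab0; rewrite -row_free_unit row_free_castmx.
apply: row_free_col_mx_orth; try exact: row_free_rows.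
(* The entries of the product of one block with the transpose of the other are the numbers
   [dotv (a i) (b j)]. *)
apply/matrixP => i j; rewrite mxE [RHS]mxE -[RHS](ab0 i j) dotvE.
by apply: eq_bigr => k _; rewrite !mxE.
Qed.

Lemma stack_rows_mul_widen (R : realType) (n P : nat) (hPn : (P <= n)%N)
    (a : 'I_P -> 'cV[R]_n) (b : 'I_(n - P) -> 'cV[R]_n) (s : 'cV[R]_n) i :
  (stack_rows hPn a b *m s) (widen_ord hPn i) 0 = dotv (a i) s.
Proof.
rewrite mxE dotvE; apply: eq_bigr => k _; rewrite castmxE /= cast_ord_id.
have -> : cast_ord (esym (subnKC hPn)) (widen_ord hPn i) = lshift (n - P) i.
  exact: val_inj.
by rewrite col_mxEu !mxE.
Qed.

Lemma tensor_app_diag (R : realType) (n : nat) (t : 'I_n -> R) (s : 'cV[R]_n) :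
  tensor_app (diag_tensor t) s = \sum_j t j * s j 0 ^+ 3.
Proof.
apply: eq_bigr => i _.
(* For fixed [i], only the term with [j = i] and [k = i] survives. *)
rewrite (bigD1 i) //= (bigD1 i) //= /diag_tensor eqxx /= !big1 ?addr0.
- by rewrite -!mulrA.
- by move=> j ji; apply: big1 => k _; rewrite eq_sym (negPf ji) !mul0r.
- by move=> k ki; rewrite eq_sym (negPf ki) !mul0r.
Qed.

(** The cube of a sum expands into a triple sum; the sum over [l] is then moved inward past [i], [j]
    and [k] in turn. *)
Lemma tensor_app_sum_cubes (R : realType) (n P : nat) (a : 'I_P -> 'cV[R]_n)
    (s : 'cV[R]_n) :
  tensor_app (sum_cubes_tensor a) s = \sum_l dotv (a l) s ^+ 3.
Proof.
have cubeE l : dotv (a l) s ^+ 3 = \sum_i \sum_j \sum_k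
    outer3 (a l) (a l) (a l) i j k * s i 0 * s j 0 * s k 0.
  rewrite dotvE !exprS expr0 mulr1 mulr_suml; apply: eq_bigr => i _.
  rewrite mulr_suml mulr_sumr; apply: eq_bigr => j _.
  rewrite !mulr_sumr; apply: eq_bigr => k _.
  by rewrite /outer3; ring.
under [RHS]eq_bigr do rewrite cubeE.
rewrite [RHS]exchange_big; apply: eq_bigr => i _.
rewrite [RHS]exchange_big; apply: eq_bigr => j _.
rewrite [RHS]exchange_big; apply: eq_bigr => k _.
by rewrite /sum_cubes_tensor !mulr_suml.
Qed.

Lemma dotv_change_basis (R : realType) (n : nat) (C : 'M[R]_n)
    (g s : 'cV[R]_n) :
  C \in unitmx -> dotv ((invmx C)^T *m g) (C *m s) = dotv g s.
Proof. by move=> uC; rewrite /dotv trmx_mul trmxK -mulmxA mulKmx. Qed.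

(** The inverse cancels on both sides: $C^{-1}(Cs) = s$ on the right, and $C^T C^{-T} = (C^{-1}C)^T
    = 1$ on the left. *)
Lemma quad_change_basis (R : realType) (n : nat) (C A : 'M[R]_n)
    (s : 'cV[R]_n) :
  C \in unitmx -> quad ((invmx C)^T *m A *m invmx C) (C *m s) = quad A s.
Proof.
move=> uC; rewrite /quad trmx_mul -!mulmxA mulKmx // [C^T *m _]mulmxA.
by rewrite -trmx_mul mulVmx // trmx1 mul1mx.
Qed.

Theorem theorem3p1 (R : realType) (n P : nat)
    (hP : (1 <= P)%N) (hPn : (P <= n)%N)
    (f0 : R) (g : 'cV[R]_n)
    (H : 'M[R]_n) (hH : H \is symmetricmx)
    (sigma : R) (hsigma : 0 < sigma)
    (W : 'M[R]_n) (hW : sym_posdef W)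
    (a : 'I_P -> 'cV[R]_n) (ha : free (codom a))
    (aperp : 'I_(n - P) -> 'cV[R]_n) (haperp : free (codom aperp))
    (horth : forall (i : 'I_P) (j : 'I_(n - P)), dotv (a i) (aperp j) = 0) :
  let C := stack_rows hPn a aperp in
  let C_inv_T := (invmx C)^T in
  let g' := C_inv_T *m g in
  let H' := C_inv_T *m H *m invmx C in
  let W' := C_inv_T *m W *m invmx C in
  let t := fun j : 'I_n => if (j < P)%N then 1 else 0 in
  forall s : 'cV[R]_n,
    let s' := C *m s in
    model f0 g' H' (diag_tensor t) sigma W' s'
    = model f0 g H (sum_cubes_tensor a) sigma W s.
Proof.
move=> C C_inv_T g' H' W' t s s'.
have uC : C \in unitmx by exact: stack_rows_unit.
(* With [normv] unfolded, the same lemma treats both the [H] term and the [W] term. *)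
rewrite /model /normv dotv_change_basis // !quad_change_basis //.
congr (_ + _ * _ + _); rewrite tensor_app_diag tensor_app_sum_cubes.
(* The weight [t] is the indicator of [j < P]; the restricted sum is then reindexed by ['I_P]
   through [widen_ord]. *)
transitivity (\sum_(j < n | (j < P)%N) s' j 0 ^+ 3).
  rewrite [RHS]big_mkcond; apply: eq_bigr => j _.
  by rewrite /t; case: ifP; rewrite ?mul1r ?mul0r.
rewrite big_ord_narrow; apply: eq_bigr => i _.
by rewrite stack_rows_mul_widen.
Qed.
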